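(* As $N\to\infty$, the projective logarithmic energy of collections of $N$ points in the real projective plane $\mathbb{RP}^2$ satisfies $$\min_{\omega_N\subset\mathbb{RP}^2}\mathscr{E}^{\mathbb P}_{\log}(\omega_N)\ \ge\ W_{\log}(\mathbb{RP}^2)N^2-\frac12N\log N+\left(C_{\log}-\frac12\log2\right)N+o(N),$$ where $W_{\log}(\mathbb{RP}^2)=1-\log2$ and $C_{\log}$ is the constant defined in the context. Here $C_{\log}-\frac12\log 2\ge-\frac34+\frac12\log2=-0.403426\ldots$
   Context: Points of $\mathbb{RP}^2$ are represented by unit vectors $x\in\mathbb{S}^2\subset\mathbb{R}^3$, with $x$ and $-x$ identified. The projective distance is $d_{\mathbb P}(x,y)=\sqrt{1-\langle x,y\rangle^2}$, and for $\omega_N=\{x_1,\dots,x_N\}\subset\mathbb{RP}^2$, $$\mathscr{E}^{\mathbb P}_{\log}(\omega_N)=-\sum_{i\ne j}\log d_{\mathbb P}(x_i,x_j)=-\sum_{i\neq j}\log\sqrt{1-\langle x_i,x_j\rangle^2}$$ (sum over ordered pairs). The constant $C_{\log}$: let $m_N$ be the minimum of $\mathscr{E}_{\log}(\omega_N)=\sum_{i\ne j}\log\|x_i-x_j\|^{-1}$ over all collections $\omega_N=\{x_1,\dots,x_N\}$ of $N$ points on $\mathbb{S}^2$. It is known from the literature that there is a constant $C_{\log}$ such that $$m_N=W_{\log}(\mathbb{S}^2)N^2-\frac12N\log N+C_{\log}N+o(N),\qquad W_{\log}(\mathbb{S}^2)=\frac12-\log2,$$ and that $C_{\log}\ge-\frac34+\log2$.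 $C_{\log}$ denotes this constant. *)

(* Defs.v *)
From mathcomp Require Import all_boot all_order all_algebra.
From mathcomp Require Import all_classical all_reals all_analysis.

Set Implicit Arguments.
Unset Strict Implicit.
Unset Printing Implicit Defensive.

Import Order.TTheory GRing.Theory Num.Theory.
Import numFieldNormedType.Exports.

Local Open Scope classical_set_scope.
Local Open Scope ring_scope.

Section Geometry.
Context {R : realType}.
Implicit Types x y : 'rV[R]_3.

Definition dot x y : R := \sum_(k < 3) x ord0 k * y ord0 k.

(* The library norm `|x| on 'rV[R]_3 is the sup norm, not the Euclidean one. *)
Definition enorm x : R := Num.sqrt (dot x x).

Definition sphere2 : set 'rV[R]_3 := [set x | enorm x = 1].

(* A point of the real projective plane is represented by a unit vector; two
   unit vectors represent the same point when they are equal up to sign. *)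
Definition proj_eq x y : Prop := x = y \/ x = - y.

Definition proj_dist x y : R := Num.sqrt (1 - dot x y ^+ 2).

End Geometry.

Section Energy.
Context {R : realType}.

(* The points of a collection are pairwise distinct. This matters because the
   library has ln 0 = 0, whereas a repeated point has infinite energy. *)
Definition sphere_config (N : nat) : set ('I_N -> 'rV[R]_3) :=
  [set w | (forall i, sphere2 (w i)) /\ (forall i j, i != j -> w i <> w j)].

Definition proj_config (N : nat) : set ('I_N -> 'rV[R]_3) :=
  [set w | (forall i, sphere2 (w i)) /\
           (forall i j, i != j -> ~ proj_eq (w i) (w j))].

Definition log_energy (N : nat) (w : 'I_N -> 'rV[R]_3) : R :=
  \sum_(i < N) \sum_(j < N | i != j) ln (enorm (w i - w j))^-1.

Definition proj_log_energy (N : nat) (w : 'I_N -> 'rV[R]_3) : R :=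
  - \sum_(i < N) \sum_(j < N | i != j) ln (proj_dist (w i) (w j)).

Definition is_minimum (A : set R) (m : R) : Prop := A m /\ lbound A m.

Definition is_min_log_energy (N : nat) (m : R) : Prop :=
  is_minimum [set log_energy w | w in @sphere_config N] m.

Definition is_min_proj_log_energy (N : nat) (m : R) : Prop :=
  is_minimum [set proj_log_energy w | w in @proj_config N] m.

Definition Wlog_sphere : R := 1 / 2 - ln 2.

Definition Wlog_proj : R := 1 - ln 2.

(* C is the coefficient of N in the expansion of the minimal energy m N on the
   sphere; the expansion determines C uniquely. *)
Definition is_Clog (C : R) : Prop :=
  exists m : nat -> R,
    (forall N, is_min_log_energy N (m N)) /\
    (fun N => m N - (Wlog_sphere * N%:R ^+ 2 - 1 / 2 * N%:R * ln N%:R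
                     + C * N%:R)) =o_\oo (fun N => N%:R : R).

End Energy.

(* Main.v *)
(** Lifting [N] lines to the [2 N] unit vectors [± x_i] turns projective energy
    into spherical energy: [|x - y| |x + y| = 2 d_P(x, y)] for unit vectors, so
    the spherical energy of the lift is [2 E_P - 2 N ^ 2 log 2], hence
    [E_P >= m_(2N) / 2 + N ^ 2 log 2]; the expansion of [m_(2N)] gives the bound.
    Projective minimizers exist because the product of all distances is
    continuous on the compact set of [N]-tuples of unit vectors and is positive
    exactly on genuine configurations. *)
Require Import Defs.
From mathcomp Require Import all_boot all_order all_algebra.
From mathcomp Require Import all_classical all_reals all_analysis.
From mathcomp Require Import ring lra.
Import Order.TTheory GRing.Theory Num.Theory.
Import numFieldNormedType.Exports.
Local Open Scope classical_set_scope.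
Local Open Scope ring_scope.

(** * Euclidean norm and projective distance on unit vectors *)

Lemma dot_add_sub {R : realType} (x y : 'rV[R]_3) :
  dot (x + y) (x + y) = dot x x + 2 * dot x y + dot y y /\
  dot (x - y) (x - y) = dot x x - 2 * dot x y + dot y y.
Proof.
by rewrite /dot !big_ord_recl !big_ord0 !mxE; split; ring.
Qed.

Lemma dotNN {R : realType} (x : 'rV[R]_3) : dot (- x) (- x) = dot x x.
Proof. by apply: eq_bigr => k _; rewrite !mxE mulrNN. Qed.

Lemma dot_ge0 {R : realType} (x : 'rV[R]_3) : 0 <= dot x x.
Proof. by apply: sumr_ge0 => k _; rewrite -expr2 sqr_ge0. Qed.

Lemma dot_eq0 {R : realType} (x : 'rV[R]_3) : dot x x = 0 -> x = 0.
Proof.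
move=> /eqP; rewrite psumr_eq0; last by move=> k _; rewrite -expr2 sqr_ge0.
move=> /allP x0; apply/rowP => k; rewrite mxE.
have := x0 k; rewrite mem_index_enum => /(_ isT) /=.
by rewrite mulf_eq0 orbb => /eqP.
Qed.

Lemma enorm_gt0 {R : realType} (x : 'rV[R]_3) : x != 0 -> 0 < enorm x.
Proof.
move=> x0; rewrite sqrtr_gt0 lt_neqAle dot_ge0 andbT eq_sym.
by apply: contra x0 => /eqP /dot_eq0 /eqP.
Qed.

Lemma enorm0 {R : realType} : enorm (0 : 'rV[R]_3) = 0.
Proof. by rewrite /enorm /dot big1 ?sqrtr0// => k _; rewrite mxE mul0r. Qed.

Lemma enormN {R : realType} (x : 'rV[R]_3) : enorm (- x) = enorm x.
Proof. by rewrite /enorm dotNN. Qed.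

Lemma sphere2P {R : realType} (x : 'rV[R]_3) : sphere2 x <-> dot x x = 1.
Proof.
rewrite /sphere2 /= /enorm; split=> [x1|->]; last exact: sqrtr1.
by rewrite -[LHS]sqr_sqrtr ?dot_ge0// x1 expr1n.
Qed.

Lemma sphere2N {R : realType} (x : 'rV[R]_3) : sphere2 x -> sphere2 (- x).
Proof. by rewrite /sphere2 /= enormN. Qed.

Lemma enorm_double {R : realType} (x : 'rV[R]_3) :
  sphere2 x -> enorm (x + x) = 2.
Proof.
move=> /sphere2P x1; rewrite /enorm (dot_add_sub x x).1 x1.
rewrite (_ : 1 + 2 * 1 + 1 = 2 ^+ 2 :> R); last by ring.
by rewrite sqrtr_sqr ger0_norm.
Qed.

(** With [t = dot x y], the squared norms are [2 - 2 t] and [2 + 2 t], whose product is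
    [4 (1 - t ^ 2)]. *)
Lemma enorm_sub_add {R : realType} (x y : 'rV[R]_3) :
  sphere2 x -> sphere2 y -> enorm (x - y) * enorm (x + y) = 2 * proj_dist x y.
Proof.
move=> /sphere2P x1 /sphere2P y1.
rewrite /enorm /proj_dist -sqrtrM ?dot_ge0//.
rewrite (dot_add_sub x y).1 (dot_add_sub x y).2 x1 y1.
rewrite (_ : _ * _ = 2 ^+ 2 * (1 - dot x y ^+ 2)); last by ring.
by rewrite sqrtrM ?sqr_ge0// sqrtr_sqr ger0_norm.
Qed.

(** By the product formula, the distance vanishes exactly when [x - y] or [x + y] does. *)
Lemma proj_dist_gt0 {R : realType} (x y : 'rV[R]_3) :
  sphere2 x -> sphere2 y -> (0 < proj_dist x y) <-> ~ proj_eq x y.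
Proof.
move=> x1 y1; have xy := enorm_sub_add x y x1 y1; split=> [d0 [e|e]|nxy].
- have e0 : enorm (x - y) = 0 by rewrite e subrr enorm0.
  by rewrite e0 mul0r in xy; lra.
- have e0 : enorm (x + y) = 0 by rewrite e addNr enorm0.
  by rewrite e0 mulr0 in xy; lra.
suff : 0 < 2 * proj_dist x y by lra.
rewrite -xy mulr_gt0 ?enorm_gt0//; apply/eqP => /eqP.
  by rewrite subr_eq0 => /eqP e; apply: nxy; left.
by rewrite addr_eq0 => /eqP e; apply: nxy; right.
Qed.

(** * The antipodal double and its energy *)

Definition antipodal_double {R : realType} {N : nat} (w : 'I_N -> 'rV[R]_3)
    (k : 'I_(N + N)) : 'rV[R]_3 :=
  match fintype.split k with inl i => w i | inr i => - w i end.

Lemma antipodal_doubleE {R : realType} {N : nat} (w : 'I_N -> 'rV[R]_3) i :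
  antipodal_double w (lshift N i) = w i /\
  antipodal_double w (rshift N i) = - w i.
Proof.
rewrite /antipodal_double.
by rewrite (unsplitK (inl i)) (unsplitK (inr i)).
Qed.

Lemma antipodal_double_config {R : realType} {N : nat} (w : 'I_N -> 'rV[R]_3) :
  proj_config w -> sphere_config (antipodal_double w).
Proof.
move=> [w1 wd].
(* For [i = j], the equality would make [w j + w j] zero, although its norm is [2]. *)
have wNw i j : w i <> - w j.
  have [->|ij] := eqVneq i j; last by move=> e; apply: (wd i j ij); right.
  move=> /eqP; rewrite -addr_eq0 => /eqP e.
  have := enorm_double _ (w1 j); rewrite e enorm0 => /eqP.
  by rewrite eq_sym pnatr_eq0.
have wI i j : w i = w j -> i = j.
  by move=> e; apply/eqP/negPn/negP => ij; apply: (wd i j ij); left.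
split=> [k|k l].
  rewrite /antipodal_double; case: fintype.split => i //; exact: sphere2N.
rewrite -(splitK k) -(splitK l) /antipodal_double !unsplitK.
case: (fintype.split k) => i; case: (fintype.split l) => j /=.
- by move=> ij /wI e; rewrite e eqxx in ij.
- by move=> _ /wNw.
- by move=> _ /esym /wNw.
- by move=> ij /oppr_inj /wI e; rewrite e eqxx in ij.
Qed.

(** An ordered pair of distinct lines lifts to four ordered pairs of vectors; the pairs formed by
    [w i] and [- w i] contribute separately. *)
Lemma log_energy_antipodal_double {R : realType} {N : nat}
    (w : 'I_N -> 'rV[R]_3) :
  proj_config w ->
  log_energy (antipodal_double w) =
  2 * proj_log_energy w - 2 * N%:R ^+ 2 * ln 2.
Proof.
move=> [w1 wd].
have pairE i j : i != j ->
    ln (enorm (w i - w j))^-1 + ln (enorm (w i + w j))^-1 =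
    - ln 2 - ln (proj_dist (w i) (w j)).
  move=> ij.
  have d0 : 0 < proj_dist (w i) (w j) by apply/proj_dist_gt0 => //; exact: wd.
  have /andP[xy0 yx0] : (0 < enorm (w i - w j)) && (0 < enorm (w i + w j)).
    by apply/andP; split; apply: enorm_gt0; rewrite ?subr_eq0 ?addr_eq0;
       apply/eqP => e; apply: (wd i j ij); [left|right].
  rewrite !lnV ?posrE// -!opprD -!lnM ?posrE// enorm_sub_add//.
set a := fun i j => ln (enorm (w i - w j))^-1.
set b := fun i j => ln (enorm (w i + w j))^-1.
(* Two equal-sign blocks give [a] off the diagonal. Two mixed-sign blocks give [b] with the diagonal
   included. *)
have -> : log_energy (antipodal_double w) =
    2 * (\sum_(i < N) (\sum_(j < N | i != j) a i j + \sum_(j < N) b i j)).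
  rewrite /log_energy big_split_ord /= mulrDl !mul1r; congr (_ + _).
    apply: eq_bigr => i _; rewrite big_split_ord /=; congr (_ + _).
      apply: eq_big => [j|j _]; first by rewrite eq_shift.
      by rewrite !(antipodal_doubleE w _).1.
    apply: eq_big => [j|j _]; first by rewrite eq_shift.
    by rewrite (antipodal_doubleE w _).1 (antipodal_doubleE w _).2 opprK.
  apply: eq_bigr => i _; rewrite big_split_ord /= addrC; congr (_ + _).
    apply: eq_big => [j|j _]; first by rewrite eq_shift.
    by rewrite !(antipodal_doubleE w _).2 opprK addrC /a -enormN opprB.
  apply: eq_big => [j|j _]; first by rewrite eq_shift.
  by rewrite (antipodal_doubleE w _).1 (antipodal_doubleE w _).2 -opprD enormN.
(* The diagonal term [b i i] is [- ln 2], and each of the [N - 1] other indices adds one more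
   [- ln 2]. *)
have rowE i : \sum_(j < N | i != j) a i j + \sum_(j < N) b i j =
    - N%:R * ln 2 - \sum_(j < N | i != j) ln (proj_dist (w i) (w j)).
  have -> : N%:R = 1 + \sum_(j < N | i != j) 1 :> R.
    under eq_bigl do rewrite eq_sym.
    have -> : N%:R = \sum_(j < N) 1 :> R by rewrite sumr_const card_ord.
    by rewrite (bigD1 i).
  rewrite [\sum_(j < N) b i j](bigD1 i)//= {1}/b enorm_double// addrCA lnV ?posrE//.
  under [X in _ + (_ + X)]eq_bigl do rewrite eq_sym.
  rewrite -big_split/= (eq_bigr _ (fun j => pairE i j)) sumrB.
  rewrite !sumr_const -[(- ln 2) *+ _]mulr_natl; ring.
rewrite (eq_bigr _ (fun i _ => rowE i)) sumrB sumr_const card_ord.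
rewrite /proj_log_energy -mulr_natl; ring.
Qed.

(** * Existence of projective minimizers *)

(** The lines spanned by [(1, i, 0)] have distinct slopes. Such a configuration makes the maximal
    distance product positive. *)
Lemma proj_config_nonempty {R : realType} (N : nat) :
  exists w : 'I_N -> 'rV[R]_3, proj_config w.
Proof.
pose v (i : 'I_N) : 'rV[R]_3 := \row_k [:: 1; i%:R; 0]`_k.
pose c (i : 'I_N) := (enorm (v i))^-1.
have c_gt0 i : 0 < c i.
  rewrite invr_gt0; apply: enorm_gt0; apply/eqP => /rowP /(_ ord0).
  by rewrite !mxE /= => /eqP; rewrite oner_eq0.
exists (fun i => c i *: v i); split=> [i|i j ij].
  apply/sphere2P.
  have -> : dot (c i *: v i) (c i *: v i) = c i ^+ 2 * dot (v i) (v i).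
    by rewrite /dot mulr_sumr; apply: eq_bigr => k _; rewrite !mxE; ring.
  rewrite -[dot _ _]sqr_sqrtr ?dot_ge0// -exprMn mulVf ?expr1n//.
  by rewrite -invr_eq0 gt_eqF ?c_gt0.
pose o1 : 'I_3 := Ordinal (isT : (1 < 3)%N).
have vE i' : ((c i' *: v i') ord0 ord0 = c i') *
             ((c i' *: v i') ord0 o1 = c i' * i'%:R) *
             ((- (c i' *: v i')) ord0 ord0 = - c i').
  by do 2?split; rewrite !mxE //= mulr1.
have ci := c_gt0 i; have cj := c_gt0 j.
have coord k (u u' : 'rV[R]_3) : u = u' -> u ord0 k = u' ord0 k by move=> ->.
(* Positive first coordinates exclude opposite vectors. For equal vectors they force [c i = c j],
   and the second coordinates then give [i = j]. *)
move=> [e|e]; have := coord ord0 _ _ e; rewrite !vE; last by lra.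
move=> cij; have := coord o1 _ _ e; rewrite !vE cij => /mulfI.
rewrite gt_eqF// => /(_ isT) /eqP; rewrite eqr_nat => /eqP /val_inj eij.
by rewrite eij eqxx in ij.
Qed.

Lemma dot_continuous {R : realType} {T : topologicalType}
    (f g : T -> 'rV[R]_3) :
  continuous f -> continuous g -> continuous (fun t => dot (f t) (g t)).
Proof.
move=> cf cg t; rewrite /dot.
apply: cvg_big => [x|k _]; first exact: add_continuous.
by apply: cvgM; apply: (@continuous_comp _ _ _ _ (fun M : 'rV[R]_3 => M ord0 k));
  [exact: cf|exact: coord_continuous|exact: cg|exact: coord_continuous].
Qed.

Lemma sphere2_compact {R : realType} : compact (@sphere2 R).
Proof.
apply: bounded_closed_compact.
  (* For the sup norm it suffices that each squared coordinate is at most [dot x x = 1]. *)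
  exists 1; split; rewrite ?num_real// => M M1 x /sphere2P x1.
  rewrite /= [`|x|]/Num.Def.normr /= mx_normrE.
  apply: bigmax_le => [|[i k] _]; first by rewrite ltW// (lt_trans _ M1).
  apply: le_trans (ltW M1); rewrite (ord1 i) /=.
  rewrite -(@ler_pXn2r _ 2)// ?nnegrE// expr1n real_normK ?num_real//.
  rewrite -x1 /dot (bigD1 k)//= -expr2 lerDl sumr_ge0// => l _.
  by rewrite -expr2 sqr_ge0.
have -> : @sphere2 R = (fun x => dot x x) @^-1` [set 1].
  by apply/seteqP; split => x /sphere2P.
apply: preimage_closed; last exact: closed_eq.
by move=> x _; apply: dot_continuous => y; exact: cvg_id.
Qed.

(** On configurations this is the exponential of minus the energy. It stays continuous at coincident
    points, where the convention [ln 0 = 0] would spoil the energy itself. *)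
Definition dist_prod {R : realType} {N : nat} (w : 'I_N -> 'rV[R]_3) : R :=
  \prod_(i < N) \prod_(j < N | i != j) proj_dist (w i) (w j).

(** Positivity is carried through the induction because [lnM] needs positive factors. *)
Lemma ln_prod {R : realType} (I : Type) (r : seq I) (P : pred I) (F : I -> R) :
  (forall i, P i -> 0 < F i) ->
  0 < \prod_(i <- r | P i) F i /\
  ln (\prod_(i <- r | P i) F i) = \sum_(i <- r | P i) ln (F i).
Proof.
move=> F0.
apply: (big_rec2 (fun p s => 0 < p /\ ln p = s)) => [|i s p Pi [p0 <-]].
  by rewrite ltr01 ln1.
by split; [rewrite mulr_gt0 ?F0|rewrite lnM ?posrE ?F0].
Qed.

Lemma dist_prod_gt0 {R : realType} {N : nat} (w : 'I_N -> 'rV[R]_3) :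
  (forall i, sphere2 (w i)) -> 0 < dist_prod w <-> proj_config w.
Proof.
move=> w1; split=> [w0|[_ wd]].
  split=> // i j ij; apply/proj_dist_gt0 => //.
  rewrite lt_neqAle sqrtr_ge0 andbT eq_sym; apply: contraTneq w0 => d0.
  by rewrite /dist_prod (bigD1 i)//= (bigD1 j)//= d0 !mul0r ltxx.
apply: prodr_gt0 => i _; apply: prodr_gt0 => j ij.
by apply/proj_dist_gt0 => //; exact: wd.
Qed.

Lemma proj_log_energyE {R : realType} {N : nat} (w : 'I_N -> 'rV[R]_3) :
  proj_config w -> proj_log_energy w = - ln (dist_prod w).
Proof.
move=> [w1 wd].
have d0 i j : i != j -> 0 < proj_dist (w i) (w j).
  by move=> ij; apply/proj_dist_gt0 => //; exact: wd.
rewrite /proj_log_energy /dist_prod.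
have row0 i := ln_prod 'I_N (index_enum 'I_N) (fun j => i != j) _ (d0 i).
rewrite (ln_prod _ _ _ _ (fun i _ => (row0 i).1)).2; congr (- _).
by apply: eq_bigr => i _; rewrite (row0 i).2.
Qed.

Lemma dist_prod_continuous {R : realType} {T : topologicalType} {N : nat}
    (f : 'I_N -> T -> 'rV[R]_3) :
  (forall i, continuous (f i)) -> continuous (fun t => dist_prod (f ^~ t)).
Proof.
move=> fc t; have mulc : continuous (fun x : R * R => x.1 * x.2).
  exact: mul_continuous.
apply: cvg_big => // i _; apply: cvg_big => // j _.
apply: (@continuous_comp _ _ _ (fun t => 1 - dot (f i t) (f j t) ^+ 2)
  (@Num.sqrt R)); last exact: sqrt_continuous.
apply: cvgB; first exact: cvg_cst.
by rewrite expr2; under eq_fun do rewrite expr2;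
  apply: cvgM; apply: dot_continuous; exact: fc.
Qed.

Lemma exists_min_proj_log_energy {R : realType} (N : nat) :
  exists m : R, is_min_proj_log_energy N m.
Proof.
(* The product topology on tuples makes Tychonoff's theorem applicable. *)
pose T := prod_topology (fun _ : 'I_N => 'rV[R]_3).
pose A := [set w : T | forall i, sphere2 (w i)].
have Acompact : compact A.
  apply: (@tychonoff 'I_N (fun=> 'rV[R]_3) (fun=> @sphere2 R)) => i.
  exact: sphere2_compact.
have [w0 w0c] := proj_config_nonempty (R := R) N.
have A0 : A !=set0 by exists w0; case: w0c.
have ccont (i : 'I_N) : continuous (fun w : T => w i).
  exact: (@proj_continuous _ (fun _ : 'I_N => 'rV[R]_3)).
have Pcont := dist_prod_continuous _ ccont.
have [w /set_mem wA wmax] := compact_EVT_max A0 Acompact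
  (continuous_subspaceT Pcont).
have wmax' (u : 'I_N -> 'rV[R]_3) : proj_config u -> dist_prod u <= dist_prod w.
  by move=> [u1 _]; apply: (wmax u); apply/mem_set.
(* The maximal product is at least the positive product of [w0], so no two points of the maximizer
   coincide. *)
have wc : proj_config w.
  by apply/dist_prod_gt0 => //; apply: lt_le_trans (wmax' _ w0c);
    apply/dist_prod_gt0 => //; case: w0c.
exists (proj_log_energy w); split; first by exists w.
move=> _ [u uc <-]; rewrite !proj_log_energyE// lerN2 ler_ln ?wmax'//.
  by rewrite posrE; apply/dist_prod_gt0 => //; case: uc.
by rewrite posrE; apply/dist_prod_gt0.
Qed.

(** * Numerical bounds for [ln 2] *)

(* Taking [s = 1] or [s = -1] gives the lower or the upper bound. *)
Lemma ln_ratio_compare {R : realType} (s b : R) (p dp : R -> R) :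
  0 <= b < 1 -> (forall y : R, is_derive y 1 p (dp y)) ->
  (forall y, 0 < y < b -> 0 <= s * (2 / (1 - y ^+ 2) - dp y)) ->
  0 <= s * (ln (1 + b) - ln (1 - b) - (p b - p 0)).
Proof.
move=> /andP[b0 b1] dpP pb.
(* As [ln (1 + y) - ln (1 - y)] has derivative [2 / (1 - y ^ 2)], [F] is nondecreasing on
   [[0, b]]. *)
pose F y := s * (ln (1 + y) - ln (1 - y) - p y).
have dF y : 0 <= y <= b -> is_derive y 1 F (s * (2 / (1 - y ^+ 2) - dp y)).
  move=> /andP[y0 yb].
  have y1 : 0 < 1 + y by lra.
  have y2 : 0 < 1 - y by lra.
  have d1 : is_derive y 1 (fun y : R => ln (1 + y)) (1 + y)^-1.
    rewrite -[_^-1]mulr1; apply: (@is_derive1_comp _ _ (fun y => 1 + y)).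
      exact: is_derive1_ln.
    by apply: is_derive_eq; rewrite add0r mul1r.
  have d2 : is_derive y 1 (fun y : R => ln (1 - y)) (- (1 - y)^-1).
    rewrite -mulrN1; apply: (@is_derive1_comp _ _ (fun y => 1 - y)).
      exact: is_derive1_ln.
    by apply: is_derive_eq; rewrite add0r mul1r.
  have dpy := dpP y.
  apply: is_derive_eq; rewrite /GRing.scale /=.
  have -> : 1 - y ^+ 2 = (1 + y) * (1 - y) by ring.
  by field; rewrite !gt_eqF.
have dF' (y : R) : y \in `]0, b[ ->
    is_derive y 1 F (s * (2 / (1 - y ^+ 2) - dp y)).
  by rewrite in_itv /= => /andP[y0 yb]; apply: dF; rewrite !ltW.
have Fcont : {within `[0, b], continuous F}.
  apply: derivable_within_continuous => y.
  by rewrite in_itv /= => /dF [].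
have -> : s * (ln (1 + b) - ln (1 - b) - (p b - p 0)) = F b - F 0.
  by rewrite /F addr0 subr0 ln1; ring.
rewrite subr_ge0; apply: (ger0_derive1_le_cc (f := F) _ _ Fcont) => //.
- by move=> y /dF' [].
- move=> y yb; have dFy := dF' y yb; rewrite derive1E derive_val.
  by apply: pb; move: yb; rewrite in_itv.
- by rewrite in_itv /= lexx.
- by rewrite in_itv /= lexx andbT.
Qed.

(** The bounds are twice [0.346573] and [0.346574], the precision that the digits [0.403426]
    require. *)
Lemma ln2_bounds {R : realType} :
  693 / 10 ^+ 3 + 146 / 10 ^+ 6 < ln 2 :> R /\
  ln 2 < 693 / 10 ^+ 3 + 148 / 10 ^+ 6 :> R.
Proof.
(* [ln 2] is [ln ((1 + x) / (1 - x))] at [x = 1 / 3]; the last coefficient [c]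
   absorbs the tail of the series. *)
pose p c (y : R) := 2 * y + 2 / 3 * y ^+ 3 + 2 / 5 * y ^+ 5 + 2 / 7 * y ^+ 7
  + 2 / 9 * y ^+ 9 + c / 11 * y ^+ 11.
pose dp c (y : R) := 2 + 2 * y ^+ 2 + 2 * y ^+ 4 + 2 * y ^+ 6 + 2 * y ^+ 8
  + c * y ^+ 10.
have dpP c (y : R) : is_derive y 1 (p c) (dp c y).
  by apply: is_derive_eq; rewrite /dp /GRing.scale /=; field.
(* The terms of [dp] up to [y ^ 8] truncate the geometric series of [2 / (1 - y ^ 2)], whose tail is
   [y ^ 10] times the whole series. *)
have remE c (y : R) : 0 < y < 3^-1 ->
    2 / (1 - y ^+ 2) - dp c y = y ^+ 10 * (2 / (1 - y ^+ 2) - c).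
  move=> y13; rewrite /dp; field; apply: lt0r_neq0; nra.
have b1 : 0 <= (3^-1 : R) < 1 by lra.
have ln2E : ln (1 + 3^-1) - ln (1 - 3^-1) = ln 2 :> R.
  have -> : 2 = (1 + 3^-1) / (1 - 3^-1) :> R.
    by apply: (canRL (mulfK _)); [apply: lt0r_neq0|]; lra.
  by rewrite ln_div// posrE; lra.
(* On []0, 1/3[], [2 / (1 - y ^ 2)] lies between its endpoint values [2] and [9 / 4], hence the two
   choices of [c]. *)
have lo : 0 <= 1 * (ln 2 - (p 2 3^-1 - p 2 0)).
  rewrite -ln2E; apply: (ln_ratio_compare _ _ _ _ b1 (dpP 2)) => y yb.
  rewrite remE// mul1r mulr_ge0 ?exprn_ge0//; first by lra.
  by rewrite subr_ge0 ler_pdivlMr; nra.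
have hi : 0 <= -1 * (ln 2 - (p (9 / 4) 3^-1 - p (9 / 4) 0)).
  rewrite -ln2E; apply: (ln_ratio_compare _ _ _ _ b1 (dpP _)) => y yb.
  rewrite remE// mulN1r -mulrN mulr_ge0 ?exprn_ge0//; first by lra.
  by rewrite oppr_ge0 subr_le0 ler_pdivrMr; nra.
move: lo hi; rewrite /p; lra.
Qed.

(** * Transfer of the asymptotic expansion *)

(** Halving [|g (2 N)| <= e * 2 N] gives [e * N], so the same [e] and threshold serve. *)
Lemma littleo_double {R : realType} (g : nat -> R) :
  g =o_\oo (fun N => N%:R : R) ->
  (fun N => g (N + N)%N / 2) =o_\oo (fun N => N%:R : R).
Proof.
move=> /eqoP go; apply/eqoP => e e0; have [M _ gM] := go e e0.
exists M => // N /= MN; have := gM (N + N)%N (leq_trans MN (leq_addr _ _)).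
by rewrite /= normrM !normr_nat natrD (@ger0_norm _ 2^-1) ?invr_ge0//; lra.
Qed.

Theorem proposition1p2 (R : realType) (C : R) (hC : is_Clog C) :
  (exists mP : nat -> R,
     (forall N, is_min_proj_log_energy N (mP N)) /\
     exists r : nat -> R,
       r =o_\oo (fun N => N%:R : R) /\
       forall N, Wlog_proj * N%:R ^+ 2 - 1 / 2 * N%:R * ln N%:R
                   + (C - 1 / 2 * ln 2) * N%:R + r N <= mP N) /\
  (- (3 / 4) + ln 2 <= C -> - (3 / 4) + 1 / 2 * ln 2 <= C - 1 / 2 * ln 2) /\
  - (403 / 10 ^+ 3 + 427 / 10 ^+ 6) < - (3 / 4) + 1 / 2 * ln 2 :> R /\
  - (3 / 4) + 1 / 2 * ln 2 <= - (403 / 10 ^+ 3 + 426 / 10 ^+ 6) :> R.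
Proof.
have [lo hi] := @ln2_bounds R.
split; last by split; [move=> ?|split]; lra.
have [mP mPP] := choice (@exists_min_proj_log_energy R).
exists mP; split=> //.
have [m [mmin mo]] := hC.
(* The remainder is half the spherical remainder at [2 N]. *)
have ro := littleo_double _ mo; eexists; split; first exact: ro.
move=> N /=; have [[w wc <-] _] := mPP N.
have [_ mlb] := mmin (N + N)%N.
have : m (N + N)%N <= log_energy (antipodal_double w).
  by apply: mlb; exists (antipodal_double w) => //; exact: antipodal_double_config.
rewrite log_energy_antipodal_double//.
have -> : (N + N)%:R = 2 * N%:R :> R by rewrite natrD; ring.
(* The factor [N%:R] keeps the identity true at [N = 0], where [ln 0 = 0] breaks the product
   rule. *)
have Nln : N%:R * ln (2 * N%:R) = N%:R * (ln 2 + ln N%:R) :> R.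
  case: N {w wc mlb} => [|N]; first by rewrite !mul0r.
  by rewrite lnM ?posrE.
rewrite /Wlog_proj /Wlog_sphere.
rewrite (_ : 1 / 2 * (2 * N%:R) * _ = N%:R * ln (2 * N%:R)); last by field.
(* Halving [m (2 N)] and adding [N ^ 2 * ln 2] turns [2 * (1 / 2 - ln 2)] into [1 - ln 2]; the term
   [ln (2 N)] shifts [C] by [- 1 / 2 * ln 2]. *)
rewrite Nln; lra.
Qed.
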